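(* Let $K$ be a field of characteristic different from $2$ and let $F_{p,q}=F_{p,q}(\mathfrak B_{\rm sup})$ be the free bicommutative superalgebra over $K$ freely generated by $p$ even generators $y_1,\dots,y_p$ and $q$ odd generators $z_1,\dots,z_q$. The dimensions of its homogeneous components are as follows. For $\mathbf k=(k_1,\dots,k_p)$ and $\mathbf l=(l_1,\dots,l_q)$ with nonnegative integer entries, $$\dim(F_{p,q}^{(\mathbf k,\mathbf l)})=\prod_{i=1}^p(k_i+1)\prod_{j=1}^q(\delta_{2,l_j}+2\delta_{1,l_j}+\delta_{0,l_j})-2\prod_{j=1}^q(\delta_{1,l_j}+\delta_{0,l_j})\quad\text{if }\sum_{i=1}^pk_i+\sum_{j=1}^ql_j>1,$$ and $\dim(F_{p,q}^{(\mathbf k,\mathbf l)})=1$ if $\sum_{i=1}^pk_i+\sum_{j=1}^ql_j=1$. Moreover, for nonnegative integers $k,l$, $$\dim(F_{p,q}^{(k,l)})=\begin{cases}\displaystyle\binom{k+2p-1}{k}\binom{2q}{l}-2\binom{k+p-1}{k}\binom{q}{l},&\text{if }k+l>1;\\ p,&\text{if }(k,l)=(1,0);\\ q,&\text{if }(k,l)=(0,1).\end{cases}$$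
   Context: Algebras are not assumed associative or unital. A superalgebra is an algebra $A=A_0\oplus A_1$ with $A_iA_j\subseteq A_{i+j\,(\mathrm{mod}\,2)}$; for $a\in A_i$ write $\overline a=i$. A superalgebra is bicommutative if for all homogeneous elements $x_1(x_2x_3)=(-1)^{\overline{x_1}\,\overline{x_2}}x_2(x_1x_3)$ and $(x_1x_2)x_3=(-1)^{\overline{x_2}\,\overline{x_3}}(x_1x_3)x_2$. The free bicommutative superalgebra on given even and odd generators is defined by the usual universal property with respect to parity-preserving maps of the generators. $F_{p,q}^{(k,l)}$ is the component of elements homogeneous of degree $k$ in the even generators and degree $l$ in the odd generators; $F_{p,q}^{(\mathbf k,\mathbf l)}$ is the component of elements homogeneous of degree $k_i$ in $y_i$ and $l_j$ in $z_j$ for all $i,j$. $\delta_{i,j}$ is the Kronecker delta. The binomial coefficient $\binom{k+r-1}{k}$ denotes the coefficient of $u^k$ in $(1-u)^{-r}$; in particular $\binom{-1}{0}=1$ (relevant only if $p=0$). *)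

(* Defs.v *)
From HB Require Import structures.
From mathcomp Require Import all_boot all_order all_algebra.

Set Implicit Arguments.
Unset Strict Implicit.
Unset Printing Implicit Defensive.

Import GRing.Theory.
Local Open Scope ring_scope.

(* Subspaces are Prop-valued predicates on a possibly infinite-dimensional
   space, so {vspace _} and \dim do not apply. *)

Definition subspace (K : fieldType) (V : lmodType K) (S : V -> Prop) : Prop :=
  S 0 /\ forall (a : K) (u v : V), S u -> S v -> S (a *: u + v).

Definition spanned (K : fieldType) (V : lmodType K) (S : V -> Prop) (v : V) :
    Prop :=
  exists (n : nat) (c : 'I_n -> K) (u : 'I_n -> V),
    (forall i, S (u i)) /\ v = \sum_(i < n) c i *: u i.

Definition has_dim (K : fieldType) (V : lmodType K) (S : V -> Prop) (n : nat) :
    Prop :=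
  exists b : 'I_n -> V,
    [/\ forall i, S (b i),
        forall c : 'I_n -> K,
          \sum_(i < n) c i *: b i = 0 -> forall i, c i = 0
      & forall v, S v -> exists c : 'I_n -> K, v = \sum_(i < n) c i *: b i].

(* Not necessarily associative or unital. Parities are booleans: sa_part false
   is the even part A_0 and sa_part true the odd part A_1; addition of parities
   mod 2 is (+) and their product is &&. *)
Record superalgebra (K : fieldType) := SuperAlgebra {
  sa_sort :> lmodType K;
  sa_mul : sa_sort -> sa_sort -> sa_sort;
  sa_mul_linearr : forall a : sa_sort, linear (sa_mul a);
  sa_mul_linearl : forall b : sa_sort, linear (fun a => sa_mul a b);
  sa_part : bool -> sa_sort -> Prop;
  sa_part_subspace : forall i : bool, subspace (sa_part i);
  sa_part_sum : forall a : sa_sort,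
    exists a0 a1, [/\ sa_part false a0, sa_part true a1 & a = a0 + a1];
  sa_part_direct : forall a : sa_sort,
    sa_part false a -> sa_part true a -> a = 0;
  sa_part_mul : forall (i j : bool) (a b : sa_sort),
    sa_part i a -> sa_part j b -> sa_part (i (+) j) (sa_mul a b)
}.

Definition bicommutative (K : fieldType) (A : superalgebra K) : Prop :=
  forall (i1 i2 i3 : bool) (x1 x2 x3 : A),
    sa_part i1 x1 -> sa_part i2 x2 -> sa_part i3 x3 ->
    sa_mul x1 (sa_mul x2 x3)
      = (-1) ^+ (i1 && i2) *: sa_mul x2 (sa_mul x1 x3)
    /\ sa_mul (sa_mul x1 x2) x3
      = (-1) ^+ (i2 && i3) *: sa_mul (sa_mul x1 x3) x2.

Definition superalgebra_hom (K : fieldType) (A B : superalgebra K)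
    (f : {linear A -> B}) : Prop :=
  (forall a b : A, f (sa_mul a b) = sa_mul (f a) (f b))
  /\ (forall (i : bool) (a : A), sa_part i a -> sa_part i (f a)).

Definition free_bicommutative (K : fieldType) (p q : nat) (F : superalgebra K)
    (y : 'I_p -> F) (z : 'I_q -> F) : Prop :=
  [/\ bicommutative F,
      forall i, sa_part false (y i),
      forall j, sa_part true (z j)
    & forall (A : superalgebra K) (y' : 'I_p -> A) (z' : 'I_q -> A),
        bicommutative A ->
        (forall i, sa_part false (y' i)) ->
        (forall j, sa_part true (z' j)) ->
        exists f : {linear F -> A},
          [/\ superalgebra_hom f, forall i, f (y i) = y' i,
              forall j, f (z j) = z' j
            & forall g : {linear F -> A},
                superalgebra_hom g -> (forall i, g (y i) = y' i) ->
                (forall j, g (z j) = z' j) -> g =1 f]].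

(* Nonassociative words; inl i stands for y_i and inr j for z_j. *)
Inductive word (p q : nat) : Type :=
  | Gen of 'I_p + 'I_q
  | Mul of word p q & word p q.

Fixpoint word_eval (K : fieldType) (p q : nat) (F : superalgebra K)
    (y : 'I_p -> F) (z : 'I_q -> F) (w : word p q) : F :=
  match w with
  | Gen (inl i) => y i
  | Gen (inr j) => z j
  | Mul w1 w2 => sa_mul (word_eval y z w1) (word_eval y z w2)
  end.

Fixpoint word_deg (p q : nat) (w : word p q) (x : 'I_p + 'I_q) : nat :=
  match w with
  | Gen t => (t == x)%N
  | Mul w1 w2 => (word_deg w1 x + word_deg w2 x)%N
  end.

Definition multi_component (K : fieldType) (p q : nat) (F : superalgebra K)
    (y : 'I_p -> F) (z : 'I_q -> F) (k : 'I_p -> nat) (l : 'I_q -> nat) :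
    F -> Prop :=
  spanned (fun v : F => exists w : word p q,
    [/\ forall i, word_deg w (inl i) = k i,
        forall j, word_deg w (inr j) = l j
      & v = word_eval y z w]).

Definition bi_component (K : fieldType) (p q : nat) (F : superalgebra K)
    (y : 'I_p -> F) (z : 'I_q -> F) (k l : nat) : F -> Prop :=
  spanned (fun v : F => exists w : word p q,
    [/\ (\sum_(i < p) word_deg w (inl i))%N = k,
        (\sum_(j < q) word_deg w (inr j))%N = l
      & v = word_eval y z w]).

(* The binomial coefficient (k + r - 1 choose k), read as the coefficient of
   u^k in (1 - u)^(-r). The truncated predecessor gives the right value at
   r = 0; the two lemmas below characterize these coefficients. *)
Definition multichoose (r k : nat) : nat := 'C((k + r).-1, k).

Lemma multichoose0 k : multichoose 0 k = (k == 0)%N.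
Proof. by case: k => [|k] //; rewrite /multichoose addn0 bin_small. Qed.

Lemma multichooseS r k :
  multichoose r.+1 k = (\sum_(i < k.+1) multichoose r i)%N.
Proof.
elim: k => [|k IHk]; first by rewrite big_ord1 /multichoose !bin0.
by rewrite big_ord_recr /= -IHk /multichoose addSn addnS /= binS addnC.
Qed.

(* Main.v *)
Require Import Defs.
From HB Require Import structures.
From mathcomp Require Import all_boot all_order all_algebra zify.

Set Implicit Arguments.
Unset Strict Implicit.
Unset Printing Implicit Defensive.

Import GRing.Theory.
Local Open Scope ring_scope.

(** In a bicommutative superalgebra, left multiplications by generators commute
    with each other up to sign, so do right multiplications, and on products a
    left multiplication commutes with a right one ([bc_swap]). Hence every
    product of generators is, up to sign, a normal form: generators acting from
    the left and from the right on a product of two generators, with at least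
    one letter on each side, depending up to sign only on the multiset of left
    letters and the multiset of right letters ([eq_exponent_congr]). An odd
    letter repeated on one side makes the word zero in characteristic different
    from 2 ([word_eval_odd_square]). So a component of degree above 1 is spanned
    by the supercommutative monomials in two copies of the generators, one copy
    for each side, that involve both copies.

    These monomials are independent because of the following model. Let [S] be
    the supercommutative algebra on the two copies of the generators. The space
    [S * S] with the product [(a, b) (c, d) = (a d, a d)] is a bicommutative
    superalgebra ([bicomm_double_bicommutative]). Sending each generator to the
    pair of its two copies sends a word to a nonzero multiple of its monomial
    ([model_evalE]), and the universal property transports the independence of
    monomials in [S] to the free algebra ([free_independent]).

    It remains to count. A generator occurring [k_i] or [l_j] times distributes
    over the two copies in [k_i + 1] ways if it is even, and in 1, 2, 1 or 0
    ways for [l_j] equal to 0, 1, 2 or more if it is odd. The monomials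
    that miss one of the copies have to be removed, which gives the subtracted
    term ([card_nonvanishing], [has_dim_products]). For the coarser grading the
    same count is made with generating functions: a truncated geometric series
    for each even variable and [1 + X] for each odd one. *)

(** * Bilinearity of the product *)

Section Bilinearity.
Variables (K : fieldType) (A : superalgebra K).
Implicit Types (a b : A) (c : K).

Lemma sa_mulDr a b b' : sa_mul a (b + b') = sa_mul a b + sa_mul a b'.
Proof. by have := sa_mul_linearr a 1 b b'; rewrite !scale1r. Qed.

Lemma sa_mulDl a a' b : sa_mul (a + a') b = sa_mul a b + sa_mul a' b.
Proof. by have /= := sa_mul_linearl b 1 a a'; rewrite !scale1r. Qed.

Lemma sa_mul0r a : sa_mul a 0 = 0.
Proof. by apply: (@addrI _ (sa_mul a 0)); rewrite -sa_mulDr !addr0. Qed.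

Lemma sa_mul0l b : sa_mul 0 b = 0.
Proof. by apply: (@addrI _ (sa_mul 0 b)); rewrite -sa_mulDl !addr0. Qed.

Lemma sa_mulZr c a b : sa_mul a (c *: b) = c *: sa_mul a b.
Proof. by rewrite -[c *: b]addr0 sa_mul_linearr sa_mul0r addr0. Qed.

Lemma sa_mulZl c a b : sa_mul (c *: a) b = c *: sa_mul a b.
Proof.
by rewrite -[c *: a]addr0 (sa_mul_linearl b c a 0) sa_mul0l addr0.
Qed.
End Bilinearity.

(** * Bicommutative superalgebras from supercommutative ones *)

Definition supercommutative (K : fieldType) (S : superalgebra K) : Prop :=
  forall (i j : bool) (a b : S), sa_part i a -> sa_part j b ->
    sa_mul a b = (-1) ^+ (i && j) *: sa_mul b a.

Section Double.
Variables (K : fieldType) (S : superalgebra K).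

(** On pairs, only the first component of a left factor and the second
    component of a right factor matter, and a product lands on the diagonal.
    Hence a generator can act differently from the left and from the right,
    while a product acts on both sides as one element of [S]. *)
Definition double_mul (a b : S * S) : S * S :=
  (sa_mul a.1 b.2, sa_mul a.1 b.2).

Definition double_part (i : bool) (a : S * S) : Prop :=
  sa_part i a.1 /\ sa_part i a.2.

Lemma double_mul_linearr a : linear (double_mul a).
Proof.
by move=> c u v; rewrite /double_mul /= sa_mul_linearr; congr pair.
Qed.

Lemma double_mul_linearl b : linear (fun a => double_mul a b).
Proof.
by move=> c u v; rewrite /double_mul /= (sa_mul_linearl b.2); congr pair.
Qed.

Lemma double_part_subspace i : subspace (double_part i).
Proof.
have [S0 SD] := @sa_part_subspace _ S i.
split; first by split; exact: S0.
by move=> a u v [u1 u2] [v1 v2]; split; apply: SD.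
Qed.

Lemma double_part_sum (a : S * S) :
  exists a0 a1, [/\ double_part false a0, double_part true a1 & a = a0 + a1].
Proof.
case: a => a b.
have [a0 [a1 [ha0 ha1 ->]]] := sa_part_sum a.
have [b0 [b1 [hb0 hb1 ->]]] := sa_part_sum b.
by exists (a0, b0), (a1, b1).
Qed.

Lemma double_part_direct (a : S * S) :
  double_part false a -> double_part true a -> a = 0.
Proof.
case: a => a b [/= a0 b0] [/= a1 b1].
by rewrite (sa_part_direct a0 a1) (sa_part_direct b0 b1).
Qed.

Lemma double_part_mul i j (a b : S * S) :
  double_part i a -> double_part j b ->
  double_part (i (+) j) (double_mul a b).
Proof. by move=> [a1 a2] [b1 b2]; split; apply: sa_part_mul. Qed.

Definition bicomm_double : superalgebra K :=
  SuperAlgebra double_mul_linearr double_mul_linearl double_part_subspace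
    double_part_sum double_part_direct double_part_mul.

(** Both triple products become triple products in [S], namely
    [a.1 b.1 c.2] and [a.1 b.2 c.2]; supercommutativity of [S] exchanges the
    first two factors, respectively the last two. *)
Lemma bicomm_double_bicommutative :
  associative (@sa_mul K S) -> supercommutative S ->
  bicommutative bicomm_double.
Proof.
move=> mulA mulC i1 i2 i3 [a1 a2] [b1 b2] [c1 c2].
move=> [/= ha1 ha2] [/= hb1 hb2] [/= hc1 hc2].
have E1 : sa_mul a1 (sa_mul b1 c2)
          = (-1) ^+ (i1 && i2) *: sa_mul b1 (sa_mul a1 c2).
  by rewrite !mulA (mulC _ _ _ _ ha1 hb1) sa_mulZl.
have E2 : sa_mul (sa_mul a1 b2) c2
          = (-1) ^+ (i2 && i3) *: sa_mul (sa_mul a1 c2) b2.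
  by rewrite -!mulA (mulC _ _ _ _ hb2 hc2) sa_mulZr.
by split; rewrite /= /double_mul /= ?E1 ?E2.
Qed.
End Double.

(** * Twisted monomial algebras *)

Section Twisted.
(** Multiplying the monomial of exponent [a] by that of exponent [b] gives the
    monomial of exponent [a + b] times [bichar a b], where [X i j] is the scalar
    created by moving one variable [j] to the left of one variable [i] when the
    product is sorted. Allowing [X i i = 0] forces [i] to have square zero,
    which is how odd variables are handled without any case distinction.
    Exponents above [N] are truncated, so that the algebra is a space of finite
    functions. *)
Variables (K : fieldType) (V : finType) (par : V -> bool) (X : V -> V -> K).
Variable N : nat.
Hypothesis X_sym : forall i j, X i j = (-1) ^+ (par i && par j) * X j i.

Definition bichar (a b : V -> nat) : K :=
  \prod_i \prod_j X i j ^+ (a i * b j).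

Definition mon_par (a : V -> nat) : bool := odd (\sum_i par i * a i).

Lemma bicharDl a b c :
  bichar (fun v => a v + b v)%N c = bichar a c * bichar b c.
Proof.
rewrite -big_split; apply: eq_bigr => i _; rewrite -big_split.
by apply: eq_bigr => j _; rewrite mulnDl exprD.
Qed.

Lemma bicharDr a b c :
  bichar a (fun v => b v + c v)%N = bichar a b * bichar a c.
Proof.
rewrite -big_split; apply: eq_bigr => i _; rewrite -big_split.
by apply: eq_bigr => j _; rewrite mulnDr exprD.
Qed.

Lemma eq_bichar a a' b b' : a =1 a' -> b =1 b' -> bichar a b = bichar a' b'.
Proof.
by move=> ea eb; apply: eq_bigr => i _; apply: eq_bigr => j _; rewrite ea eb.
Qed.

(** Swapping two monomials multiplies by one sign for each pair of variables
    that crosses, and the product of these signs only depends on the parities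
    of the two monomials. *)
Lemma bichar_sym a b :
  bichar a b = (-1) ^+ (mon_par a && mon_par b) * bichar b a.
Proof.
have ->: (-1) ^+ (mon_par a && mon_par b) =
    \prod_i \prod_j ((-1) ^+ (par i && par j)) ^+ (a i * b j) :> K.
  rewrite /mon_par -oddM signr_odd big_distrl /= expr_sum.
  apply: eq_bigr => i _; rewrite big_distrr /= expr_sum.
  apply: eq_bigr => j _; rewrite -exprM; congr (_ ^+ _).
  by case: (par i); case: (par j); rewrite /= ?mul1n ?mul0n ?muln0.
rewrite [bichar b a]exchange_big -big_split /=.
apply: eq_bigr => i _; rewrite -big_split; apply: eq_bigr => j _ /=.
by rewrite [X i j]X_sym exprMn (mulnC (a i)).
Qed.

Lemma bichar_neq0 a b :
  (forall i j, (0 < a i)%N -> (0 < b j)%N -> X i j != 0) -> bichar a b != 0.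
Proof.
move=> H; apply/prodf_neq0 => i _; apply/prodf_neq0 => j _.
case: (posnP (a i)) => [->|ai]; first by rewrite mul0n oner_neq0.
case: (posnP (b j)) => [->|bj]; first by rewrite muln0 oner_neq0.
by rewrite expf_neq0 ?H.
Qed.

Definition mon := {ffun V -> 'I_N.+1}.
Definition mexp (a : mon) : V -> nat := fun v => a v.
Definition tw := {ffun mon -> K^o}.

Definition msum (a b d : mon) : bool := [forall v, (a v + b v)%N == d v].

Definition tw_mul (f g : tw) : tw :=
  [ffun d => \sum_a \sum_b
     (msum a b d)%:R * (bichar (mexp a) (mexp b) * (f a * g b))].

Definition tw_part (i : bool) (f : tw) : Prop :=
  forall a, mon_par (mexp a) != i -> f a = 0.

Lemma tw_mul_linearr f : linear (tw_mul f).
Proof.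
move=> c g h; apply/ffunP => d; rewrite !ffunE.
rewrite scaler_sumr -big_split /=; apply: eq_bigr => a _.
rewrite scaler_sumr -big_split /=; apply: eq_bigr => b _.
rewrite !ffunE /GRing.scale /= !mulrDr; congr (_ + _).
by rewrite (mulrCA (f a)) (mulrCA (bichar _ _)) (mulrCA (_%:R)).
Qed.

Lemma tw_mul_linearl g : linear (tw_mul^~ g).
Proof.
move=> c f h; apply/ffunP => d; rewrite !ffunE.
rewrite scaler_sumr -big_split /=; apply: eq_bigr => a _.
rewrite scaler_sumr -big_split /=; apply: eq_bigr => b _.
rewrite !ffunE /GRing.scale /= mulrDl !mulrDr; congr (_ + _).
by rewrite -(mulrA c) (mulrCA (bichar _ _)) (mulrCA (_%:R)).
Qed.

Lemma tw_part_subspace i : subspace (tw_part i).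
Proof.
split=> [a _|c f g hf hg a ha]; first by rewrite ffunE.
by rewrite !ffunE hf // hg // scaler0 addr0.
Qed.

Lemma tw_part_sum (f : tw) :
  exists f0 f1, [/\ tw_part false f0, tw_part true f1 & f = f0 + f1].
Proof.
pose h i : tw := [ffun a => if mon_par (mexp a) == i then f a else 0].
exists (h false), (h true); split.
- by move=> a /negbTE ha; rewrite ffunE ha.
- by move=> a /negbTE ha; rewrite ffunE ha.
by apply/ffunP => a; rewrite !ffunE; case: mon_par; rewrite /= ?add0r ?addr0.
Qed.

Lemma tw_part_direct (f : tw) : tw_part false f -> tw_part true f -> f = 0.
Proof.
move=> f0 f1; apply/ffunP => a; rewrite ffunE.
by case E: (mon_par (mexp a)); [apply: f0|apply: f1]; rewrite E.
Qed.

Lemma mon_parD (a b : V -> nat) :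
  mon_par (fun v => a v + b v)%N = mon_par a (+) mon_par b.
Proof.
rewrite /mon_par -oddD -big_split; congr odd.
by apply: eq_bigr => i _; rewrite mulnDr.
Qed.

Lemma eq_mon_par (a b : V -> nat) : a =1 b -> mon_par a = mon_par b.
Proof. by move=> e; congr odd; apply: eq_bigr => i _; rewrite e. Qed.

Lemma msum_mon_par a b d : msum a b d ->
  mon_par (mexp d) = mon_par (mexp a) (+) mon_par (mexp b).
Proof.
move=> /forallP H; rewrite -mon_parD; apply: eq_mon_par => v.
by rewrite /mexp (eqP (H v)).
Qed.

Lemma tw_part_mul i j f g :
  tw_part i f -> tw_part j g -> tw_part (i (+) j) (tw_mul f g).
Proof.
move=> hf hg d hd; rewrite ffunE big1 // => a _; rewrite big1 // => b _.
case E: (msum a b d); last by rewrite mul0r.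
move: hd; rewrite (msum_mon_par E).
have [->|/hf->] := eqVneq (mon_par (mexp a)) i; last by rewrite mul0r !mulr0.
have [->|/hg->] := eqVneq (mon_par (mexp b)) j; last by rewrite !mulr0.
by rewrite eqxx.
Qed.

Definition twisted : superalgebra K :=
  SuperAlgebra tw_mul_linearr tw_mul_linearl tw_part_subspace
    tw_part_sum tw_part_direct tw_part_mul.

Lemma twisted_supercommutative : supercommutative twisted.
Proof.
move=> i j f g /= hf hg; apply/ffunP => d; rewrite !ffunE exchange_big /=.
rewrite scaler_sumr; apply: eq_bigr => b _.
rewrite scaler_sumr; apply: eq_bigr => a _.
rewrite /GRing.scale /= [RHS]mulrCA; congr (_ * _).
  have -> : msum a b d = msum b a d; last by [].
  by apply: eq_forallb => v; rewrite addnC.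
have [fa|fa] := eqVneq (f a) 0; first by rewrite fa mul0r !mulr0.
have [gb|gb] := eqVneq (g b) 0; first by rewrite gb mul0r !mulr0.
have <- : mon_par (mexp a) = i by apply/eqP/(contraNT _ fa) => /hf ->.
have <- : mon_par (mexp b) = j by apply/eqP/(contraNT _ gb) => /hg ->.
by rewrite bichar_sym -mulrA (mulrC (f a)).
Qed.

Definition msum3 (a b c d : mon) : bool :=
  [forall v, (a v + b v + c v)%N == d v].

(** At most one exponent [e] within the bound satisfies [e = a + b]. If there is
    none, the total exponent exceeds the bound as well, so [c] is false. *)
Lemma sum_msum (a b : mon) (P : pred mon) (G : mon -> K) (c : bool) r :
  (forall e, msum a b e -> P e = c /\ G e = r) ->
  (c -> exists d : mon, forall v, a v + b v <= d v)%N ->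
  \sum_e (msum a b e)%:R * ((P e)%:R * G e) = c%:R * r.
Proof.
move=> H1 H2.
have [ltN|] := boolP [forall v, a v + b v < N.+1]%N.
  have lt v := forallP ltN v.
  have s0 : msum a b [ffun v => inord (a v + b v)].
    by apply/forallP => v; rewrite ffunE inordK.
  rewrite (bigD1 [ffun v => inord (a v + b v)]) //= big1 ?addr0.
    by rewrite s0; have [-> ->] := H1 _ s0; rewrite mul1r.
  move=> e ne; case E: (msum a b e); last by rewrite mul0r.
  case/eqP: ne; apply/ffunP => v; apply: val_inj.
  by rewrite ffunE /= inordK // (eqP (forallP E v)).
move=> /forallPn [v]; rewrite -leqNgt => hv.
rewrite big1 => [|e _].
  case: c H1 H2 => H1 H2; last by rewrite mul0r.
  by have [//|d hd] := H2; have := leq_trans hv (hd v); rewrite leqNgt ltn_ord.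
case E: (msum a b e); last by rewrite mul0r.
by move: hv; rewrite (eqP (forallP E v)) leqNgt ltn_ord.
Qed.

(** The right-hand side is also that of [tw_mul3l], since the three
    pairs of factors contribute one scalar each whatever the bracketing; this
    is associativity. *)
Lemma tw_mul3r (f g h : tw) d : tw_mul f (tw_mul g h) d =
  \sum_a \sum_b \sum_c (msum3 a b c d)%:R *
   (bichar (mexp a) (mexp b) * bichar (mexp a) (mexp c)
    * bichar (mexp b) (mexp c) * (f a * g b * h c)).
Proof.
rewrite ffunE; apply: eq_bigr => a _.
under eq_bigr => e _ do
  (rewrite ffunE big_distrr big_distrr big_distrr /=;
   under eq_bigr => b _ do rewrite big_distrr big_distrr big_distrr /=).
rewrite exchange_big; apply: eq_bigr => b _ /=.
rewrite exchange_big; apply: eq_bigr => c _ /=.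
rewrite -(@sum_msum b c (fun e => msum a e d)
  (fun e => bichar (mexp a) (mexp e) * bichar (mexp b) (mexp c)
            * (f a * g b * h c)) (msum3 a b c d)).
- apply: eq_bigr => e _; case: (msum a e d); case: (msum b c e);
    rewrite ?mul0r ?mulr0 // !mul1r.
  by rewrite -!mulrA; congr (_ * _); rewrite mulrCA !mulrA.
- move=> e /forallP H; split.
    by apply: eq_forallb => v; rewrite -addnA (eqP (H v)).
  congr (_ * _ * _); rewrite -bicharDr; apply: eq_bichar => // v.
  by rewrite /mexp (eqP (H v)).
- by move=> /forallP H; exists d => v; rewrite -(eqP (H v)) -addnA leq_addl.
Qed.

Lemma tw_mul3l (f g h : tw) d : tw_mul (tw_mul f g) h d =
  \sum_a \sum_b \sum_c (msum3 a b c d)%:R *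
   (bichar (mexp a) (mexp b) * bichar (mexp a) (mexp c)
    * bichar (mexp b) (mexp c) * (f a * g b * h c)).
Proof.
rewrite ffunE.
under eq_bigr => e _ do
  (rewrite ffunE; under eq_bigr => c _ do
   (rewrite big_distrl big_distrr big_distrr /=;
   under eq_bigr => a _ do rewrite big_distrl big_distrr big_distrr /=)).
rewrite exchange_big.
under eq_bigr => c _ do rewrite exchange_big.
rewrite exchange_big; apply: eq_bigr => a _ /=.
under eq_bigr => c _ do rewrite exchange_big.
rewrite exchange_big; apply: eq_bigr => b _ /=.
apply: eq_bigr => c _ /=.
rewrite -(@sum_msum a b (fun e => msum e c d)
  (fun e => bichar (mexp e) (mexp c) * bichar (mexp a) (mexp b)
            * (f a * g b * h c)) (msum3 a b c d)).
- apply: eq_bigr => e _; case: (msum e c d); case: (msum a b e);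
    rewrite ?mul0r ?mulr0 // !mul1r.
  by rewrite -!mulrA; congr (_ * _).
- move=> e /forallP H; split.
    by apply: eq_forallb => v; rewrite (eqP (H v)).
  congr (_ * _); rewrite -mulrA mulrC; congr (_ * _).
  rewrite -bicharDl; apply: eq_bichar => // v.
  by rewrite /mexp (eqP (H v)).
- by move=> /forallP H; exists d => v; rewrite -(eqP (H v)) leq_addr.
Qed.

Lemma twisted_assoc : associative (@sa_mul K twisted).
Proof. by move=> f g h; apply/ffunP => d; rewrite /= tw_mul3r tw_mul3l. Qed.

Definition monomial (m : V -> nat) : twisted :=
  [ffun d : mon => ([forall v, d v == m v :> nat])%:R : K^o].

Lemma monomialM m m' : sa_mul (monomial m) (monomial m') =
  bichar m m' *: monomial (fun v => m v + m' v)%N.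
Proof.
apply/ffunP => d; rewrite !ffunE /GRing.scale /=.
have [/forallP md|nmd] := boolP [forall v, d v == (m v + m' v)%N :> nat];
  last first.
  rewrite mulr0 big1 // => a _; rewrite big1 // => b _; rewrite !ffunE.
  have [/forallP s|_] := boolP (msum a b d); last by rewrite mul0r.
  have [/forallP ea|_] := boolP [forall v, a v == m v :> nat]; last first.
    by rewrite mul0r !mulr0.
  have [/forallP eb|_] := boolP [forall v, b v == m' v :> nat]; last first.
    by rewrite !mulr0.
  by case/forallP: nmd => v; rewrite -(eqP (ea v)) -(eqP (eb v)) eq_sym.
have lt1 v : (m v < N.+1)%N.
  by apply: leq_ltn_trans (ltn_ord (d v)); rewrite (eqP (md v)) leq_addr.
have lt2 v : (m' v < N.+1)%N.
  by apply: leq_ltn_trans (ltn_ord (d v)); rewrite (eqP (md v)) leq_addl.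
have E (n : V -> nat) (c : mon): (forall v, n v < N.+1)%N ->
    [forall v, c v == n v :> nat] = (c == [ffun v => inord (n v)]).
  move=> ltn; apply/forallP/eqP => [H|-> v]; last by rewrite ffunE inordK.
  by apply/ffunP => v; apply: val_inj; rewrite ffunE /= inordK // (eqP (H v)).
rewrite (bigD1 [ffun v => inord (m v)]) //= [X in _ + X]big1 ?addr0; last first.
  move=> a /negbTE na; rewrite big1 // => b _.
  by rewrite !ffunE E // na mul0r !mulr0.
rewrite (bigD1 [ffun v => inord (m' v)]) //= [X in _ + X]big1 ?addr0;
  last first.
  by move=> a /negbTE na; rewrite !ffunE (E m') // na !mulr0.
rewrite !ffunE !E // !eqxx !mulr1.
have -> : msum [ffun v => inord (m v)] [ffun v => inord (m' v)] d.
  by apply/forallP => v; rewrite !ffunE !inordK // (eqP (md v)).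
by rewrite mul1r; apply: eq_bichar => v; rewrite /mexp ffunE inordK.
Qed.
End Twisted.

(** * Words up to the bicommutative laws without signs *)

Section Words.
Variables p q : nat.
Notation T := ('I_p + 'I_q)%type.
Implicit Types (w : word p q) (x : T) (us vs : seq T).

(** The model has two variables [(x, false)] and [(x, true)] for each generator
    [x], by which [x] acts when it multiplies from the left, respectively from
    the right. [exponent s w] is the exponent of the monomial attached to [w];
    the side [s] only matters when [w] is a single generator. *)
Fixpoint exponent (s : bool) w (v : T * bool) : nat :=
  match w with
  | Gen x => v == (x, s)
  | Mul w1 w2 => exponent false w1 v + exponent true w2 v
  end.

Lemma word_deg_exponent s w x :
  word_deg w x = (exponent s w (x, false) + exponent s w (x, true))%N.
Proof.
elim: w s => [t|w1 IH1 w2 IH2] s /=.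
  by rewrite !xpair_eqE (eq_sym t); case: s; rewrite ?andbT ?andbF ?addn0.
by rewrite (IH1 false) (IH2 true) addnACA.
Qed.

Definition is_mul w : bool := if w is Mul _ _ then true else false.

Definition Lmuls us w := foldr (fun x w => Mul (Gen x) w) w us.
Definition Rmuls vs w := foldr (fun x w => Mul w (Gen x)) w vs.
Definition nf (a : T) us (b : T) vs : word p q :=
  Rmuls vs (Lmuls us (Mul (Gen a) (Gen b))).

Lemma is_mul_Lmuls us w : is_mul w -> is_mul (Lmuls us w).
Proof. by case: us. Qed.

Lemma is_mul_Rmuls vs w : is_mul w -> is_mul (Rmuls vs w).
Proof. by case: vs. Qed.

Lemma is_mul_nf a us b vs : is_mul (nf a us b vs).
Proof. by apply/is_mul_Rmuls/is_mul_Lmuls. Qed.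

Lemma exponent_nf s a us b vs v :
  exponent s (nf a us b vs) v =
  count_mem v.1 (if v.2 then b :: vs else a :: us).
Proof.
case: v => x c; rewrite /nf; elim: vs s => [|t vs IH] s /=; last first.
  by rewrite IH; case: c {IH} => /=; rewrite xpair_eqE (eq_sym x); lia.
elim: us s => [|t us IH] s /=; last first.
  by rewrite IH; case: c {IH} => /=; rewrite xpair_eqE (eq_sym x); lia.
case: c => /=; rewrite !xpair_eqE; first by rewrite (eq_sym x b); lia.
by rewrite (eq_sym x a); lia.
Qed.

(** The combinatorics of words needs the two laws only up to sign, so it is done
    for an arbitrary congruence satisfying them. *)
Record bicomm_congr (E : word p q -> word p q -> Prop) : Prop := BicommCongr {
  bc_refl : forall w, E w w;
  bc_sym : forall w w', E w w' -> E w' w;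
  bc_trans : forall w1 w2 w3, E w1 w2 -> E w2 w3 -> E w1 w3;
  bc_mul : forall w1 w1' w2 w2',
    E w1 w1' -> E w2 w2' -> E (Mul w1 w2) (Mul w1' w2');
  bc_left : forall w1 w2 w3, E (Mul w1 (Mul w2 w3)) (Mul w2 (Mul w1 w3));
  bc_right : forall w1 w2 w3, E (Mul (Mul w1 w2) w3) (Mul (Mul w1 w3) w2)
}.

Section Congruence.
Variable E : word p q -> word p q -> Prop.
Hypothesis EP : bicomm_congr E.

Let Erefl := bc_refl EP.
Let Etrans := bc_trans EP.
Let Esym := bc_sym EP.

Lemma bc_mull w1 w1' w2 : E w1 w1' -> E (Mul w1 w2) (Mul w1' w2).
Proof. by move=> e; apply: (bc_mul EP). Qed.

Lemma bc_mulr w1 w2 w2' : E w2 w2' -> E (Mul w1 w2) (Mul w1 w2').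
Proof. by move=> e; apply: (bc_mul EP). Qed.

Lemma bc_Lmuls us w w' : E w w' -> E (Lmuls us w) (Lmuls us w').
Proof. by move=> e; elim: us => //= u us IH; apply: bc_mulr. Qed.

Lemma bc_Rmuls vs w w' : E w w' -> E (Rmuls vs w) (Rmuls vs w').
Proof. by move=> e; elim: vs => //= u us IH; apply: bc_mull. Qed.

(** Left and right multiplications commute on products: with [w = a b],
    [x ((a b) r) = x ((a r) b) = (a r) (x b) = (a (x b)) r = (x (a b)) r]. *)
Lemma bc_swap w (r x : word p q) :
  is_mul w -> E (Mul x (Mul w r)) (Mul (Mul x w) r).
Proof.
case: w => // a b _.
apply: (Etrans (bc_mulr x (bc_right EP a b r))).
apply: (Etrans (bc_left EP _ _ _)).
apply: (Etrans (bc_right EP _ _ _)).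
by apply: bc_mull; apply: (bc_left EP).
Qed.

Lemma congr_foldr_perm (f : T -> word p q -> word p q) w s t :
  (forall x w w', E w w' -> E (f x w) (f x w')) ->
  (forall x x' w, E (f x (f x' w)) (f x' (f x w))) ->
  perm_eq s t -> E (foldr f w s) (foldr f w t).
Proof.
move=> fE fC; elim: s t => [|x s IH] t.
  by rewrite perm_sym => /perm_nilP ->.
move=> st; have /path.splitPr xt : x \in t by rewrite -(perm_mem st) mem_head.
case: xt st => t1 t2.
rewrite perm_sym perm_catC /= perm_cons perm_catC perm_sym => /IH st /=.
apply: (Etrans (fE x _ _ st)); elim: t1 {st IH} => //= u t1 IH.
by apply: (Etrans (fC _ _ _)); apply: fE.
Qed.

Lemma Lmuls_perm us us' w : perm_eq us us' -> E (Lmuls us w) (Lmuls us' w).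
Proof.
apply: congr_foldr_perm => [x w1 w2|x x' w1]; first exact: bc_mulr.
exact: (bc_left EP).
Qed.

Lemma Rmuls_perm vs vs' w : perm_eq vs vs' -> E (Rmuls vs w) (Rmuls vs' w).
Proof.
apply: congr_foldr_perm => [x w1 w2|x x' w1]; first exact: bc_mull.
exact: (bc_right EP).
Qed.

Lemma mul_Rmuls (x : word p q) vs w :
  is_mul w -> E (Mul x (Rmuls vs w)) (Rmuls vs (Mul x w)).
Proof.
move=> mw; elim: vs => //= v vs IH.
by apply: (Etrans (bc_swap _ _ (is_mul_Rmuls vs mw))); apply: bc_mull.
Qed.

Lemma mul_Lmuls w us w' : E (Mul w (Lmuls us w')) (Lmuls us (Mul w w')).
Proof.
elim: us => //= u us IH.
by apply: (Etrans (bc_left EP _ _ _)); apply: bc_mulr.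
Qed.

Lemma Lmuls_Rmuls us vs w :
  is_mul w -> E (Lmuls us (Rmuls vs w)) (Rmuls vs (Lmuls us w)).
Proof.
move=> mw; elim: us => //= u us IH; apply: (Etrans (bc_mulr _ IH)).
by apply: mul_Rmuls; apply: is_mul_Lmuls.
Qed.

(** The innermost left factor is no different from the other left operators:
    [a b] is the operator of [a] applied to the word [b]. *)
Lemma nf_permL a us b vs s : perm_eq (a :: us) s ->
  E (nf a us b vs) (Rmuls vs (Lmuls s (Gen b))).
Proof.
move=> e; apply: bc_Rmuls.
have -> : Lmuls us (Mul (Gen a) (Gen b)) = Lmuls (rcons us a) (Gen b).
  by rewrite /Lmuls foldr_rcons.
by apply: Lmuls_perm; rewrite perm_rcons.
Qed.

(** With the left operators moved outside, the innermost right factor becomes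
    one of the right operators, applied to the word [a]. *)
Lemma nf_permR a us b vs s : perm_eq (b :: vs) s ->
  E (nf a us b vs) (Lmuls us (Rmuls s (Gen a))).
Proof.
move=> e; apply: (Etrans (Esym (Lmuls_Rmuls us vs _))) => //.
apply: bc_Lmuls.
have -> : Rmuls vs (Mul (Gen a) (Gen b)) = Rmuls (rcons vs b) (Gen a).
  by rewrite /Rmuls foldr_rcons.
by apply: Rmuls_perm; rewrite perm_rcons.
Qed.

Lemma nf_perm a us b vs a' us' b' vs' :
  perm_eq (a :: us) (a' :: us') -> perm_eq (b :: vs) (b' :: vs') ->
  E (nf a us b vs) (nf a' us' b' vs').
Proof.
move=> eu ev; apply: (Etrans (nf_permL b vs eu)).
apply: (Etrans (Esym (nf_permL b vs (perm_refl _)))).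
apply: (Etrans (nf_permR a' us' ev)).
exact: (Esym (nf_permR a' us' (perm_refl _))).
Qed.

(** In a product of normal forms, the operators of the second factor are pulled
    out one after the other, until its innermost word [a' b'] remains; then [W]
    is moved inside next to [b'], which acts on it from the right. *)
Lemma nf_mul a us b vs a' us' b' vs' :
  E (Mul (nf a us b vs) (nf a' us' b' vs'))
    (nf a (rcons us' a' ++ us) b (vs' ++ b' :: vs)).
Proof.
set W := nf a us b vs.
have -> : nf a (rcons us' a' ++ us) b (vs' ++ b' :: vs)
    = Rmuls vs' (Rmuls (b' :: vs)
        (Lmuls (rcons us' a') (Lmuls us (Mul (Gen a) (Gen b))))).
  by rewrite /nf /Rmuls /Lmuls !foldr_cat.
apply: (Etrans (mul_Rmuls _ _ (is_mul_Lmuls _ _))) => //.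
apply: bc_Rmuls.
apply: (Etrans (mul_Lmuls _ _ _)).
apply: (Etrans (bc_Lmuls us' (bc_left EP _ _ _))).
have -> : Lmuls us' (Mul (Gen a') (Mul W (Gen b')))
    = Lmuls (rcons us' a') (Rmuls (b' :: vs) (Lmuls us (Mul (Gen a) (Gen b)))).
  by rewrite /Lmuls foldr_rcons.
by apply: Lmuls_Rmuls; apply: is_mul_Lmuls.
Qed.

Lemma nf_exists w : is_mul w -> exists a us b vs,
  E w (nf a us b vs) /\ forall s, exponent s w =1 exponent s (nf a us b vs).
Proof.
elim: w => // w1 IH1 w2 IH2 _.
case: w1 IH1 => [x|w1 w1'] IH1; case: w2 IH2 => [x'|w2 w2'] IH2.
- by exists x, [::], x', [::]; split.
- have [//|a [us [b [vs [e m]]]]] := IH2.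
  exists a, (x :: us), b, vs; split.
    apply: (Etrans (bc_mulr _ e)).
    by apply: (Etrans (mul_Rmuls _ _ (is_mul_Lmuls _ _))).
  move=> s v; rewrite [LHS]/= -/(exponent true (Mul w2 w2') v) m !exponent_nf.
  by case: v => t [] /=; rewrite xpair_eqE ?andbF //= andbT eq_sym addnCA.
- have [//|a [us [b [vs [e m]]]]] := IH1.
  exists a, us, b, (x' :: vs); split; first exact: (bc_mull _ e).
  move=> s v; rewrite [LHS]/= -/(exponent true (Mul w1 w1') v) m !exponent_nf.
  case: v => t [] /=; rewrite xpair_eqE ?andbF /= ?addn0 // andbT.
  by rewrite (eq_sym x') addnC addnCA.
have [//|a [us [b [vs [e m]]]]] := IH1.
have [//|a' [us' [b' [vs' [e' m']]]]] := IH2.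
exists a, (rcons us' a' ++ us), b, (vs' ++ b' :: vs); split.
  by apply: (Etrans (bc_mul EP e e')); apply: nf_mul.
move=> s v; rewrite [LHS]/= -/(exponent true (Mul w1 w1') v) m.
rewrite -/(exponent true (Mul w2 w2') v) m' !exponent_nf.
case: v => t [] /=; rewrite count_cat /=; last rewrite -cats1 count_cat /=; lia.
Qed.

(** The exponents of a normal form are the multiplicities of its left and right
    letters, and its class is invariant under permuting these. So the
    monomial of a word determines its class. *)
Lemma eq_exponent_congr w w' : exponent false w =1 exponent false w' -> E w w'.
Proof.
case: w w' => [x|w1 w2] [x'|w1' w2'] m.
- by have := m (x, false); rewrite /= eqxx; case: eqP => // -[->].
- have [//|a [us [b [vs [_ m']]]]] := @nf_exists (Mul w1' w2').
  by have := m (b, true); rewrite m' exponent_nf /= eqxx xpair_eqE andbF.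
- have [//|a [us [b [vs [_ m']]]]] := @nf_exists (Mul w1 w2).
  by have := m (b, true); rewrite m' exponent_nf /= eqxx xpair_eqE andbF.
have [//|a [us [b [vs [e mn]]]]] := @nf_exists (Mul w1 w2).
have [//|a' [us' [b' [vs' [e' mn']]]]] := @nf_exists (Mul w1' w2').
apply: (Etrans e); apply: (Etrans _ (Esym e')).
have H v : count_mem v.1 (if v.2 then b :: vs else a :: us)
         = count_mem v.1 (if v.2 then b' :: vs' else a' :: us').
  by rewrite -!(exponent_nf false) -mn -mn'.
by apply: nf_perm; apply/allP => t _; apply/eqP;
  [exact: (H (t, false)) | exact: (H (t, true))].
Qed.
End Congruence.

Lemma word_of_exponent (m : T * bool -> nat) :
  (exists x, 0 < m (x, false))%N -> (exists x, 0 < m (x, true))%N ->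
  exists2 w, is_mul w & forall s, exponent s w =1 m.
Proof.
pose letters c := flatten [seq nseq (m (x, c)) x | x <- enum {: T}].
have Hl c x : count_mem x (letters c) = m (x, c).
  rewrite /letters count_flatten -map_comp sumnE big_map big_enum /=.
  rewrite (bigD1 x) //= count_nseq /= eqxx mul1n big1 ?addn0 // => t /negbTE tx.
  by rewrite count_nseq /= tx.
move=> [x mx] [x' mx'].
have := Hl false; have := Hl true.
case: (letters true) => [/(_ x')|b vs Hv].
  by move=> e; rewrite -e in mx'.
case: (letters false) => [/(_ x)|a us Hu].
  by move=> e; rewrite -e in mx.
exists (nf a us b vs); first exact: is_mul_nf.
by move=> s [t []]; rewrite exponent_nf ?Hu ?Hv.
Qed.

Lemma exponent_is_mul_gt0 s w : is_mul w ->
  (exists x, 0 < exponent s w (x, false))%N /\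
  (exists x, 0 < exponent s w (x, true))%N.
Proof.
elim: w s => // w1 IH1 w2 IH2 s _; split=> /=.
  case: w1 IH1 => [x _|w w' IH]; first by exists x; rewrite /= eqxx.
  by have [//|[x hx] _] := IH false; exists x; rewrite addn_gt0 hx.
case: w2 IH2 => [x _|w w' IH]; first by exists x; rewrite /= eqxx addn1.
by have [//|_ [x hx]] := IH true; exists x; rewrite addn_gt0 hx orbT.
Qed.
End Words.

(** * The model *)

Section Model.
Variables (K : fieldType) (p q N : nat).
Notation T := ('I_p + 'I_q)%type.
Notation V := (T * bool)%type.

Definition gen_par (x : T) : bool := if x is inr _ then true else false.
Definition var_par (v : V) : bool := gen_par v.1.

(** Odd variables are sorted by their rank in the enumeration of all
    variables; any total order would do. *)
Definition commut_factor (v w : V) : K :=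
  if var_par v && var_par w then
    if v == w then 0 else (-1) ^+ (enum_rank w < enum_rank v)%N
  else 1.

Lemma commut_factor_sym v w :
  commut_factor v w = (-1) ^+ (var_par v && var_par w) * commut_factor w v.
Proof.
rewrite /commut_factor (andbC (var_par w)).
case: (var_par v && var_par w); last by rewrite mulr1.
rewrite eq_sym; case: eqVneq => [_|ne]; first by rewrite mulr0.
have : enum_rank v != enum_rank w by rewrite (inj_eq enum_rank_inj) eq_sym.
rewrite -val_eqE /= neq_ltn => /orP[] lt; rewrite lt ltnNge (ltnW lt) /=;
by rewrite ?mulr1 // expr1 mulrNN mulr1.
Qed.

Definition odd_le1 (m : V -> nat) : Prop := forall v, var_par v -> (m v <= 1)%N.

(** A factor vanishes only if an odd variable occurs in both monomials, and then
    it occurs twice in their product. *)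
Lemma bichar_commut_neq0 (m m' : V -> nat) :
  odd_le1 (fun v => m v + m' v)%N -> bichar commut_factor m m' != 0.
Proof.
move=> le1; apply: bichar_neq0 => v w mv mw; rewrite /commut_factor.
case: ifP => [/andP[ov ow]|_]; last exact: oner_neq0.
case: (eqVneq v w) => [vw|_]; last by rewrite signr_eq0.
by have := le1 v ov; rewrite -vw in mw; lia.
Qed.

Notation mvec := (monomial var_par commut_factor N).

Definition model : superalgebra K :=
  bicomm_double (twisted var_par commut_factor N).

Definition var_mon (x : T) (s : bool) : V -> nat := fun v => v == (x, s).

Definition model_gen (x : T) : model :=
  (mvec (var_mon x false), mvec (var_mon x true)).

Lemma model_bicommutative : bicommutative model.
Proof.
apply: bicomm_double_bicommutative; first exact: twisted_assoc.
exact/twisted_supercommutative/commut_factor_sym.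
Qed.

Lemma var_mon_par x s : mon_par var_par (var_mon x s) = gen_par x.
Proof.
rewrite /mon_par (bigD1 (x, s)) //= big1 ?addn0; last first.
  by move=> v /negbTE nv; rewrite /var_mon nv muln0.
by rewrite /var_mon eqxx muln1 oddb.
Qed.

Lemma monomial_part (m : V -> nat) :
  sa_part (mon_par var_par m) (mvec m).
Proof.
move=> d; rewrite ffunE; case: forallP => // dm.
by rewrite (eq_mon_par _ (a := mexp d) (b := m)) ?eqxx // => v; apply/eqP/dm.
Qed.

Lemma model_gen_part x : sa_part (gen_par x) (model_gen x).
Proof.
split; first by rewrite -(var_mon_par x false); apply: monomial_part.
by rewrite -(var_mon_par x true); apply: monomial_part.
Qed.

Definition model_eval : word p q -> model :=
  word_eval (fun i => model_gen (inl i)) (fun j => model_gen (inr j)).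

(** The value of a word is a multiple of its monomial, and the scalar is nonzero
    unless an odd variable is squared. *)
Lemma model_evalE (w : word p q) : exists c : K,
  [/\ (model_eval w).1 = c *: mvec (exponent false w),
      (model_eval w).2 = c *: mvec (exponent true w)
    & odd_le1 (exponent false w) -> c != 0].
Proof.
elim: w => [x|w1 [c1 [e1 _ n1]] w2 [c2 [_ e2 n2]]].
  by exists 1; rewrite !scale1r oner_neq0; case: x.
exists (c1 * c2 * bichar commut_factor (exponent false w1) (exponent true w2)).
have E : sa_mul (model_eval w1).1 (model_eval w2).2 =
  (c1 * c2 * bichar commut_factor (exponent false w1) (exponent true w2)) *:
   mvec (exponent false (Mul w1 w2)).
  by rewrite e1 e2 sa_mulZl sa_mulZr monomialM !scalerA.
split=> // le1; rewrite !mulf_neq0 ?bichar_commut_neq0 //.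
  by apply: n1 => v ov; have /= := le1 v ov; lia.
apply: n2 => v ov; have /= := le1 v ov.
case: w2 {e2 E le1} => [x|w w'] /=; last by lia.
by move=> _; apply: leq_b1.
Qed.
End Model.

(** * Words in the free bicommutative superalgebra *)

Section Free.
Variables (K : fieldType) (charK : 2%N \notin [pchar K]) (p q : nat).
Variables (F : superalgebra K) (y : 'I_p -> F) (z : 'I_q -> F).
Hypothesis freeF : free_bicommutative y z.

Notation T := ('I_p + 'I_q)%type.
Notation ev := (word_eval y z).

Fixpoint word_par (w : word p q) : bool :=
  match w with
  | Gen x => gen_par x
  | Mul w1 w2 => word_par w1 (+) word_par w2
  end.

Lemma word_eval_part w : sa_part (word_par w) (ev w).
Proof.
have [_ hy hz _] := freeF.
by elim: w => [[i|j]|w1 h1 w2 h2] //=; apply: sa_part_mul.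
Qed.

Definition sign_eq (w w' : word p q) : Prop :=
  exists b : bool, ev w = (-1) ^+ b *: ev w'.

Lemma sign_eq_congr : bicomm_congr sign_eq.
Proof.
have [bic _ _ _] := freeF.
split.
- by move=> w; exists false; rewrite scale1r.
- by move=> w w' [b e]; exists b; rewrite e scalerA -signr_addb addbb scale1r.
- move=> w1 w2 w3 [b e] [b' e']; exists (b (+) b').
  by rewrite e e' scalerA signr_addb.
- move=> w1 w1' w2 w2' [b e] [b' e']; exists (b (+) b').
  by rewrite /= e e' sa_mulZl sa_mulZr scalerA signr_addb.
- move=> w1 w2 w3; exists (word_par w1 && word_par w2) => /=.
  by have [] := bic _ _ _ _ _ _ (word_eval_part w1) (word_eval_part w2)
                 (word_eval_part w3).
- move=> w1 w2 w3; exists (word_par w2 && word_par w3) => /=.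
  by have [] := bic _ _ _ _ _ _ (word_eval_part w1) (word_eval_part w2)
                 (word_eval_part w3).
Qed.

Lemma sign_eq0 w w' : sign_eq w w' -> ev w' = 0 -> ev w = 0.
Proof. by move=> [b ->] ->; rewrite scaler0. Qed.

Lemma eq_opp_eq0 (v : F) : v = - v -> v = 0.
Proof.
move=> e; have n2 : 2%:R != 0 :> K by move: charK; rewrite inE.
apply/(scalerI n2); rewrite scaler0 scaler_nat mulr2n {2}e.
by rewrite subrr.
Qed.

(** This is where characteristic different from 2 enters: an odd [x] gives
    [x (x w) = - x (x w)]. *)
Lemma Lmuls_odd_square (x : T) us w : gen_par x ->
  ev (Lmuls (x :: x :: us) w) = 0.
Proof.
have [bic _ _ _] := freeF => ox /=.
have [e _] := bic _ _ _ _ _ _ (word_eval_part (Gen x)) (word_eval_part (Gen x))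
                 (word_eval_part (Lmuls us w)).
by apply: eq_opp_eq0; move: e; rewrite /= ox scaleN1r.
Qed.

Lemma Rmuls_odd_square (x : T) vs w : gen_par x ->
  ev (Rmuls (x :: x :: vs) w) = 0.
Proof.
have [bic _ _ _] := freeF => ox /=.
have [_ e] := bic _ _ _ _ _ _ (word_eval_part (Rmuls vs w))
   (word_eval_part (Gen x)) (word_eval_part (Gen x)).
by apply: eq_opp_eq0; move: e; rewrite /= ox scaleN1r.
Qed.

Lemma ev_Lmuls0 us w : ev w = 0 -> ev (Lmuls us w) = 0.
Proof. by move=> e; elim: us => //= u us ->; rewrite sa_mul0r. Qed.

Lemma ev_Rmuls0 vs w : ev w = 0 -> ev (Rmuls vs w) = 0.
Proof. by move=> e; elim: vs => //= u us ->; rewrite sa_mul0l. Qed.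

Lemma perm_double (x : T) s : (1 < count_mem x s)%N ->
  exists r, perm_eq s (x :: x :: r).
Proof.
move=> h; have xs : x \in s by rewrite -has_pred1 has_count; apply: ltnW.
have e := perm_to_rem xs.
have xr : x \in rem x s.
  rewrite -has_pred1 has_count -ltnS.
  by move/permP: (e) => /(_ (pred1 x)); rewrite /= eqxx add1n => <-.
exists (rem x (rem x s)); apply: (perm_trans e).
by rewrite perm_cons perm_to_rem.
Qed.

(** By permuting the letters, two occurrences of an odd letter on one side
    become two consecutive operators, whose composite is zero. *)
Lemma word_eval_odd_square w : ~ odd_le1 (exponent false w) -> ev w = 0.
Proof.
case: (boolP (is_mul w)) => [mw|]; last first.
  by case: w => // x _ []; move=> v _; apply: leq_b1.
have [a [us [b [vs [e m]]]]] := nf_exists sign_eq_congr mw.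
case: (boolP [forall v : T * bool, var_par v ==> (exponent false w v <= 1)%N])
  => [h|].
  by case; move=> v ov; have /implyP := forallP h v; apply.
move=> /forallPn [[x s]]; rewrite negb_imply -ltnNge => /andP[ox lt1] _.
apply: (sign_eq0 e); move: lt1; rewrite m exponent_nf.
case: s ox => ox lt1; have [r] := perm_double lt1.
  move=> /(nf_permR sign_eq_congr a us)/sign_eq0; apply.
  exact/ev_Lmuls0/Rmuls_odd_square.
move=> /(nf_permL sign_eq_congr b vs)/sign_eq0; apply.
exact/ev_Rmuls0/Lmuls_odd_square.
Qed.

(** The universal property maps the given words to nonzero multiples of pairwise
    distinct monomials of the model. *)
Lemma free_independent (I : finType) (w_ : I -> word p q) (c : I -> K) :
  (forall i, odd_le1 (exponent false (w_ i))) ->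
  (forall i j, exponent false (w_ i) =1 exponent false (w_ j) -> i = j) ->
  \sum_i c i *: ev (w_ i) = 0 -> forall i, c i = 0.
Proof.
move=> le1 inj sum0 i.
(* The bound N keeps all the monomials at hand from being truncated. *)
pose N := (\max_i \max_v exponent false (w_ i) v)%N.
have leN j v : (exponent false (w_ j) v <= N)%N.
  apply: leq_trans
    (leq_bigmax (F := fun j => \max_v exponent false (w_ j) v)%N j).
  exact: (leq_bigmax (F := fun v => exponent false (w_ j) v)).
have [_ _ _ /(_ (model K p q N) (fun i => model_gen K N (inl i))
   (fun j => model_gen K N (inr j)))] := freeF.
case.
- exact: model_bicommutative.
- by move=> k; apply: (model_gen_part _ _ (inl k)).
- by move=> k; apply: (model_gen_part _ _ (inr k)).
move=> f [[fM _] fy fz _].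
have fE w : f (ev w) = model_eval K N w.
  by elim: w => [[k|k]|w1 e1 w2 e2]; [exact: fy|exact: fz|rewrite /= fM e1 e2].
pose d : {ffun T * bool -> 'I_N.+1} :=
  [ffun v => inord (exponent false (w_ i) v)].
pose coef (v : F) : K := ((f v).1 : {ffun _ -> K^o}) d.
have coefD : {morph coef : u v / u + v >-> u + v}.
  by move=> u v; rewrite /coef linearD /= ffunE.
have coef0 : coef 0 = 0 by rewrite /coef linear0 ffunE.
have := congr1 coef sum0; rewrite coef0 (big_morph coef coefD coef0).
have dE j : [forall v, d v == exponent false (w_ j) v :> nat] = (i == j).
  apply/forallP/eqP => [e|<- v]; last by rewrite ffunE inordK ?ltnS.
  by apply: inj => v; rewrite -(eqP (e v)) ffunE inordK ?ltnS.
have [a [ea _ /(_ (le1 i)) na]] := model_evalE K N (w_ i).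
rewrite (bigD1 i) //= big1 ?addr0 => [|j /negbTE ji];
  rewrite /coef linearZ /= fE.
  rewrite ea !ffunE dE eqxx /GRing.scale /= mulr1 => /eqP.
  by rewrite mulf_eq0 (negbTE na) orbF => /eqP.
have [a' [-> _ _]] := model_evalE K N (w_ j).
by rewrite !ffunE dE eq_sym ji !scaler0.
Qed.

(** A space spanned by a class [Q] of words has a basis indexed by the monomials
    of [Q] in which no odd variable is squared; [w_] picks one word for each. *)
Lemma has_dim_words (Q : word p q -> Prop) (I : finType) (w_ : I -> word p q) :
  (forall i, Q (w_ i)) ->
  (forall i, odd_le1 (exponent false (w_ i))) ->
  (forall i j, exponent false (w_ i) =1 exponent false (w_ j) -> i = j) ->
  (forall w, Q w -> odd_le1 (exponent false w) ->
     exists i, exponent false w =1 exponent false (w_ i)) ->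
  has_dim (spanned (fun v : F => exists2 w, Q w & v = ev w)) #|I|.
Proof.
move=> Qw le1 inj complete.
exists (fun i => ev (w_ (enum_val i))); split.
- move=> i; exists 1, (fun=> 1), (fun=> ev (w_ (enum_val i))); split.
    by move=> _; exists (w_ (enum_val i)).
  by rewrite big_ord1 scale1r.
- move=> c sum0 i; rewrite -[i]enum_valK.
  apply: (@free_independent _ w_ (fun j => c (enum_rank j))) => //.
  rewrite -[RHS]sum0 (reindex (@enum_val I predT)) /=; last first.
    by apply: onW_bij; apply: enum_val_bij.
  by apply: eq_bigr => j _; rewrite enum_valK.
move=> v [n [c [u [hu ->]]]].
have /fin_all_exists [d hd] j : exists d : 'I_#|I| -> K,
    u j = \sum_i d i *: ev (w_ (enum_val i)).
  have [w Qw' ->] := hu j.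
  case: (boolP [forall v : T * bool, var_par v ==> (exponent false w v <= 1)%N])
      => [h|h].
    have [|i /(eq_exponent_congr sign_eq_congr) [b ->]] := complete w Qw'.
      by move=> t ot; have /implyP := forallP h t; apply.
    exists (fun j => if j == enum_rank i then (-1) ^+ b else 0).
    rewrite (bigD1 (enum_rank i)) //= eqxx enum_rankK big1 ?addr0 //.
    by move=> k /negbTE ->; rewrite scale0r.
  exists (fun=> 0); rewrite big1 ?word_eval_odd_square // => [|i _];
    last by rewrite scale0r.
  by move=> le; case/negP: h; apply/forallP => t; apply/implyP/le.
exists (fun i => \sum_j c j * d j i).
under eq_bigr => j _ do rewrite hd scaler_sumr.
rewrite exchange_big; apply: eq_bigr => i _.
by rewrite scaler_suml; apply: eq_bigr => j _; rewrite scalerA.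
Qed.
End Free.

(** * Counting exponents by generating functions *)

Section Counting.
Variables (J W : finType).

Lemma distr_big_forall (R : Type) (zero one : R) (times : Monoid.mul_law zero)
    (plus : Monoid.add_law zero times) (Q : J -> pred W) (F : J -> W -> R) :
  \big[times/one]_j \big[plus/zero]_(x | Q j x) F j x =
  \big[plus/zero]_(f : {ffun J -> W} | [forall j, Q j (f j)])
     \big[times/one]_j F j (f j).
Proof.
under eq_bigr => j _ do rewrite big_mkcond.
rewrite bigA_distr_bigA [RHS]big_mkcond; apply: eq_bigr => f _.
case: (boolP [forall j, Q j (f j)]) => [/forallP Qf|/forallPn[j nQ]].
  by apply: eq_bigr => j _; rewrite Qf.
have : j \in index_enum J by rewrite mem_index_enum.
elim: (index_enum J) => // i s IH; rewrite inE big_cons.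
case/predU1P => [<-|/IH ->]; last by rewrite Monoid.mulm0.
by rewrite (negbTE nQ) Monoid.mul0m.
Qed.

Lemma card_ffun_forall (Q : J -> pred W) :
  #|[pred f : {ffun J -> W} | [forall j, Q j (f j)]]| = (\prod_j #|Q j|)%N.
Proof.
under eq_bigr => j _ do rewrite -sum1_card.
by rewrite distr_big_forall -sum1_card; apply: eq_bigr => f _; rewrite big1.
Qed.

Lemma coef_gf (Q : pred W) (wt : W -> nat) d :
  (\sum_(x | Q x) 'X^(wt x) : {poly int})`_d =
  #|[pred x | Q x && (wt x == d)]|%:Z.
Proof.
rewrite coef_sum -sum1_card (big_morph Posz PoszD (erefl _)) [RHS]big_mkcondr.
by apply: eq_bigr => x _; rewrite coefXn eq_sym; case: eqP.
Qed.
End Counting.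

Lemma coef_gf_exp (J W : finType) (Q : pred W) (wt : W -> nat) d :
  ((\sum_(x | Q x) 'X^(wt x)) ^+ #|J| : {poly int})`_d =
  #|[pred f : {ffun J -> W} |
      [forall j, Q (f j)] && (\sum_j wt (f j) == d)%N]|%:Z.
Proof.
rewrite -prodr_const distr_big_forall -coef_gf; congr (polyseq _)`_d.
by apply: eq_bigr => f _; rewrite expr_sum.
Qed.

Lemma coef_gf_expT (J W : finType) (wt : W -> nat) d :
  ((\sum_x 'X^(wt x)) ^+ #|J| : {poly int})`_d =
  #|[pred f : {ffun J -> W} | \sum_j wt (f j) == d]%N|%:Z.
Proof.
rewrite (coef_gf_exp J predT); congr Posz; apply: eq_card => f; rewrite !inE.
by case: forallP => // -[].
Qed.

(** Truncating the geometric series at degree [N] does not affect the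
    coefficients up to [N]. *)
Lemma coef_geometric_exp (N r k : nat) : (k <= N)%N ->
  ((\sum_(a < N.+1) 'X^a) ^+ r : {poly int})`_k = (multichoose r k)%:Z.
Proof.
elim: r k => [|r IH] k kN.
  by rewrite expr0 coef1 multichoose0; case: k {kN}.
rewrite exprS mulr_suml coef_sum multichooseS (big_morph Posz PoszD (erefl _)).
rewrite [RHS](reindex_inj rev_ord_inj) /=.
transitivity (\sum_(a < N.+1 | (a <= k)%N) (multichoose r (k - a))%:Z).
  rewrite [RHS]big_mkcond; apply: eq_bigr => a _; rewrite coefXnM ltnNge.
  by case: (leqP a k) => //= _; apply: IH; apply: leq_trans (leq_subr _ _) kN.
rewrite (big_ord_narrow_leq kN); apply: eq_bigr => a _.
by rewrite /= subSS.
Qed.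

Lemma coef_1X_exp (r l : nat) : ((1 + 'X) ^+ r : {poly int})`_l = ('C(r, l))%:Z.
Proof.
elim: r l => [|r IH] l; first by rewrite expr0 coef1 bin0n; case: l.
rewrite exprS mulrDl mul1r coefD coefXM IH.
by case: l => [|l]; rewrite ?bin0 //= IH binS PoszD.
Qed.

Definition pair_wt (N : nat) (ab : 'I_N.+1 * 'I_N.+1) : nat := (ab.1 + ab.2)%N.
Definition bool_wt (ab : bool * bool) : nat := (ab.1 + ab.2)%N.
Definition side (A : Type) (s : bool) (ab : A * A) : A :=
  if s then ab.2 else ab.1.

Lemma gf_pair_wt N :
  \sum_(ab : 'I_N.+1 * 'I_N.+1) 'X^(pair_wt ab)
  = (\sum_(a < N.+1) 'X^a) ^+ 2 :> {poly int}.
Proof.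
rewrite expr2 big_distrlr pair_bigA /=; apply: eq_bigr => ab _.
by rewrite -exprD.
Qed.

Lemma gf_pair_wt_side N s :
  \sum_(ab : 'I_N.+1 * 'I_N.+1 | side s ab == 0 :> nat) 'X^(pair_wt ab)
  = \sum_(a < N.+1) 'X^a :> {poly int}.
Proof.
rewrite big_mkcond -(pair_bigA _ (fun a b : 'I_N.+1 =>
  if side s (a, b) == 0 :> nat then 'X^(pair_wt (a, b)) else 0)) /=.
rewrite /side /pair_wt; case: s => /=.
  apply: eq_bigr => a _; rewrite (bigD1 ord0) //= big1 ?addr0 ?addn0 //.
  by move=> b /negbTE nb; rewrite -val_eqE /= in nb; rewrite nb.
rewrite (bigD1 ord0) //= [X in _ + X]big1 ?addr0; last first.
  by move=> b /negbTE nb; rewrite -val_eqE /= in nb; rewrite nb big1.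
by apply: eq_bigr.
Qed.

Lemma gf_bool_wt :
  \sum_(ab : bool * bool) 'X^(bool_wt ab) = (1 + 'X) ^+ 2 :> {poly int}.
Proof.
rewrite -(pair_bigA _ (fun a b => 'X^(bool_wt (a, b)))) /=.
rewrite !big_bool /bool_wt /=.
rewrite expr2 mulrDl !mulrDr !mul1r mulr1 -expr2 expr0 expr1.
by rewrite addrC [_ + 1]addrC ['X^_ + _]addrC.
Qed.

Lemma gf_bool_wt_side s :
  \sum_(ab : bool * bool | ~~ side s ab) 'X^(bool_wt ab) = 1 + 'X :> {poly int}.
Proof.
rewrite big_mkcond -(pair_bigA _ (fun a b =>
  if ~~ side s (a, b) then 'X^(bool_wt (a, b)) else 0)) /=.
rewrite !big_bool /bool_wt /=.
by case: s; rewrite /= ?addr0 ?add0r expr0 expr1 addrC.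
Qed.

Lemma card_pair_wt N k : (k <= N)%N ->
  #|[pred ab : 'I_N.+1 * 'I_N.+1 | pair_wt ab == k]| = k.+1.
Proof.
move=> kN; have := coef_gf predT (@pair_wt N) k.
rewrite gf_pair_wt coef_geometric_exp // => -[].
by rewrite /multichoose addn2 /= binSn => ->.
Qed.

Lemma card_pair_wt_side N k s : (k <= N)%N ->
  #|[pred ab : 'I_N.+1 * 'I_N.+1 |
      (side s ab == 0 :> nat) && (pair_wt ab == k)]| = 1%N.
Proof.
move=> kN; have := coef_gf (fun ab : 'I_N.+1 * 'I_N.+1 => side s ab == 0 :> nat)
  (@pair_wt N) k.
have := coef_geometric_exp 1 kN; rewrite gf_pair_wt_side expr1 => -> -[].
by rewrite /multichoose addn1 /= binn => <-.
Qed.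

Lemma card_bool_wt l :
  #|[pred ab | bool_wt ab == l]| = ((l == 2) + 2 * (l == 1) + (l == 0))%N.
Proof.
have := coef_gf predT bool_wt l; rewrite gf_bool_wt coef_1X_exp => -[<-].
by case: l => [|[|[|l]]] //; rewrite bin_small.
Qed.

Lemma card_bool_wt_side l s :
  #|[pred ab | ~~ side s ab && (bool_wt ab == l)]| = ((l == 1) + (l == 0))%N.
Proof.
have := coef_gf (fun ab => ~~ side s ab) bool_wt l.
have := coef_1X_exp 1 l; rewrite gf_bool_wt_side expr1 => -> -[<-].
by case: l => [|[|l]] //; rewrite bin_small.
Qed.

(** * Monomials squarefree in the odd variables *)

Section MultiExponents.
Variables (p q N : nat).
Notation V := (('I_p + 'I_q) * bool)%type.

(** A pair holds the exponents of the variables [(x, false)] and [(x, true)] of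
    one generator; booleans encode that an odd variable occurs at most once. *)
Definition exponents :=
  ({ffun 'I_p -> 'I_N.+1 * 'I_N.+1} * {ffun 'I_q -> bool * bool})%type.

Definition exponents_fun (m : exponents) (v : V) : nat :=
  match v.1 with
  | inl i => side v.2 (m.1 i)
  | inr j => side v.2 (m.2 j)
  end.

Lemma exponents_fun_inj m m' : exponents_fun m =1 exponents_fun m' -> m = m'.
Proof.
case: m m' => [f g] [f' g'] H; congr pair; apply/ffunP => i.
  have := H (inl i, false); have := H (inl i, true);
    rewrite /exponents_fun /side /=.
  by case: (f i) (f' i) => a b [a' b'] /= /val_inj -> /val_inj ->.
have := H (inr i, false); have := H (inr i, true).
rewrite /exponents_fun /side /=.
by case: (g i) (g' i) => [[] []] [[] []].
Qed.

Lemma exponents_odd_le1 m : odd_le1 (exponents_fun m).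
Proof. by case=> [[i|j] s] // _; apply: leq_b1. Qed.

Lemma exponents_exists (n : V -> nat) :
  odd_le1 n -> (forall i s, n (inl i, s) <= N)%N ->
  exists m, exponents_fun m =1 n.
Proof.
move=> le1 leN.
(* Clipping an odd exponent to a boolean loses nothing as it is at most 1. *)
exists ([ffun i => (inord (n (inl i, false)), inord (n (inl i, true)))],
   [ffun j => (0 < n (inr j, false), 0 < n (inr j, true))%N]).
case=> [[i|j] s]; rewrite /exponents_fun /= ffunE.
  by case: s; rewrite /= inordK ?ltnS.
by have := le1 (inr j, s) isT; case: s => /=; case: (n _) => [|[]].
Qed.

Definition vanishes (s : bool) (m : exponents) : bool :=
  [forall i, side s (m.1 i) == 0 :> nat] && [forall j, ~~ side s (m.2 j)].

Lemma vanishesPn s m :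
  reflect (exists x, 0 < exponents_fun m (x, s))%N (~~ vanishes s m).
Proof.
rewrite /vanishes negb_and; apply: (iffP orP).
  case=> /forallPn[i h]; first by exists (inl i); rewrite lt0n.
  by exists (inr i); rewrite /exponents_fun /= lt0b -[side _ _]negbK.
case=> -[i|j] h; [left|right]; apply/forallPn.
  by exists i; rewrite -lt0n.
by exists j; rewrite negbK; move: h; rewrite /exponents_fun /= lt0b.
Qed.

(** A monomial is that of a product of words if and only if it involves
    variables of both sides; the other monomials of a component are counted by
    the last two terms, which are disjoint because a component of positive
    degree does not contain the constant monomial. *)
Lemma card_nonvanishing (C : pred exponents) :
  (forall m, C m -> ~~ (vanishes false m && vanishes true m)) ->
  (#|[pred m | [&& C m, ~~ vanishes false m & ~~ vanishes true m]]|
   + #|[pred m | C m && vanishes false m]|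
   + #|[pred m | C m && vanishes true m]|)%N
  = #|C|.
Proof.
move=> H; pose v0 : pred exponents := vanishes false.
pose v1 : pred exponents := vanishes true.
rewrite -(cardID v0 C) -(cardID v1 [predD C & v0]) addnC addnA addnAC addnA
  [X in (X + _)%N = _]addnC.
congr (_ + _ + _)%N; apply: eq_card => m; rewrite !inE /v0 /v1 /in_mem /=;
  have := H m; case: (C m) => [/(_ isT)|_];
  by case: (vanishes false m); case: (vanishes true m).
Qed.

Lemma card_exponents_split (C1 : pred _) (C2 : pred _) :
  #|[pred m : exponents | C1 m.1 && C2 m.2]| = (#|C1| * #|C2|)%N.
Proof. by rewrite -cardX. Qed.
End MultiExponents.

(** * Dimensions of the components *)

Definition word_total (p q : nat) (w : word p q) : nat :=
  (\sum_(i < p) word_deg w (inl i) + \sum_(j < q) word_deg w (inr j))%N.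

Lemma word_total_Gen p q (x : 'I_p + 'I_q) : word_total (Gen x) = 1%N.
Proof.
rewrite /word_total -(big_sumType _ predT (fun t => word_deg (Gen x) t)) /=.
by rewrite (bigD1 x) //= eqxx big1 // => t /negbTE; rewrite eq_sym => ->.
Qed.

Lemma word_total_Mul p q (w w' : word p q) :
  word_total (Mul w w') = (word_total w + word_total w')%N.
Proof. by rewrite /word_total /= !big_split addnACA. Qed.

Lemma word_total_gt0 p q (w : word p q) : (0 < word_total w)%N.
Proof.
elim: w => [x|w h w' h']; first by rewrite word_total_Gen.
by rewrite word_total_Mul addn_gt0 h.
Qed.

Lemma is_mul_word_total p q (w : word p q) : is_mul w = (1 < word_total w)%N.
Proof.
case: w => [x|w w']; first by rewrite word_total_Gen.
rewrite word_total_Mul.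
have := word_total_gt0 w; have := word_total_gt0 w' => h h'.
by rewrite (leq_add h' h).
Qed.

Lemma word_deg_exponents p q N (w : word p q) (m : exponents p q N) :
  exponent false w =1 exponents_fun m ->
  (forall i, word_deg w (inl i) = pair_wt (m.1 i)) /\
  (forall j, word_deg w (inr j) = bool_wt (m.2 j)).
Proof. by move=> e; split=> i; rewrite (word_deg_exponent false) !e. Qed.

Lemma has_dim_ext (K : fieldType) (V : lmodType K) (P Q : V -> Prop) n :
  (forall v, P v <-> Q v) -> has_dim (spanned P) n -> has_dim (spanned Q) n.
Proof.
have spanW (R R' : V -> Prop) v :
    (forall v, R v -> R' v) -> spanned R v -> spanned R' v.
  by move=> RR' [k [c [u [hu ->]]]]; exists k, c, u; split=> // i; apply: RR'.
move=> PQ [b [hb ind gen]]; exists b; split=> //.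
  by move=> i; apply: spanW (hb i) => v /PQ.
by move=> v hv; apply: gen; apply: spanW hv => u /PQ.
Qed.

Lemma forallb_andb (I : finType) (P Q : pred I) :
  [forall i, P i] && [forall i, Q i] = [forall i, P i && Q i].
Proof.
apply/andP/forallP => [[/forallP hP /forallP hQ] i|h]; first by rewrite hP hQ.
by split; apply/forallP => i; have /andP[] := h i.
Qed.

Section Dim.
Variables (K : fieldType) (charK : 2%N \notin [pchar K]) (p q : nat).
Variables (F : superalgebra K) (y : 'I_p -> F) (z : 'I_q -> F).
Hypothesis freeF : free_bicommutative y z.

Notation wspan Q :=
  (spanned (fun v : F => exists2 w, Q w & v = word_eval y z w)).

(** The common part of both dimension formulas. Monomials split into an even and
    an odd part, described by [C1] and [C2]; of the [c1 * c2] monomials,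
    [e1 * e2] have no variable on a given side [s]. As the total degree exceeds
    1, all words in question are products. *)
Lemma has_dim_products (Q : word p q -> Prop) (k l : nat)
    (C1 : pred {ffun 'I_p -> 'I_k.+1 * 'I_k.+1})
    (C2 : pred {ffun 'I_q -> bool * bool}) (c1 c2 e1 e2 : nat) :
  (1 < k + l)%N ->
  (forall w, Q w -> (\sum_(i < p) word_deg w (inl i))%N = k /\
                    (\sum_(j < q) word_deg w (inr j))%N = l) ->
  (forall w (m : exponents p q k), exponent false w =1 exponents_fun m ->
     (Q w <-> C1 m.1 && C2 m.2)) ->
  (forall f, C1 f -> (\sum_i pair_wt (f i))%N = k) ->
  (forall g, C2 g -> (\sum_j bool_wt (g j))%N = l) ->
  #|C1| = c1 -> #|C2| = c2 ->
  (forall s, #|[pred f : {ffun 'I_p -> 'I_k.+1 * 'I_k.+1} |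
     [forall i, side s (f i) == 0 :> nat] && C1 f]| = e1) ->
  (forall s, #|[pred g : {ffun 'I_q -> bool * bool} |
     [forall j, ~~ side s (g j)] && C2 g]| = e2) ->
  exists2 d : nat, has_dim (wspan Q) d
    & d%:Z = c1%:Z * c2%:Z - 2 * (e1%:Z * e2%:Z).
Proof.
move=> kl Qdeg QC C1k C2l card1 card2 cards1 cards2.
pose C : pred (exponents p q k) := fun m => C1 m.1 && C2 m.2.
pose B : pred (exponents p q k) :=
  fun m => [&& C m, ~~ vanishes false m & ~~ vanishes true m].
have Qmul w : Q w -> is_mul w.
  by move=> /Qdeg[ek el]; rewrite is_mul_word_total /word_total ek el.
have wordP (m : {m | B m}) : exists w,
    [/\ Q w, is_mul w & exponent false w =1 exponents_fun (val m)].
  case: m => m /= /and3P[Cm /vanishesPn v0 /vanishesPn v1].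
  have [w mw ew] := word_of_exponent v0 v1.
  by exists w; split=> //; apply/(QC w m).
have [w_ hw_] := fin_all_exists wordP.
exists #|{: {m | B m}}|.
  apply: (has_dim_words charK freeF (w_ := w_)).
  - by move=> m; have [] := hw_ m.
  - move=> m v ov; have [_ _ ->] := hw_ m.
    exact: exponents_odd_le1.
  - move=> m m' e; apply: val_inj; apply: exponents_fun_inj => v.
    by have [_ _ <-] := hw_ m; have [_ _ <-] := hw_ m'.
  move=> w Qw le1.
  have [|m em] := exponents_exists (N := k) le1.
    move=> i s; have [<- _] := Qdeg w Qw.
    rewrite (bigD1 i) //= (word_deg_exponent false); case: s; lia.
  have Bm : B m.
    have [[x0 h0] [x1 h1]] := exponent_is_mul_gt0 false (Qmul w Qw).
    apply/and3P; split; first exact/(QC w m).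
      by apply/vanishesPn; exists x0; rewrite em.
    by apply/vanishesPn; exists x1; rewrite em.
  exists (exist _ m Bm) => v; have [_ _ ->] := hw_ (exist _ m Bm).
  by rewrite em.
have vanE s : #|[pred m | C m && vanishes s m]| = (e1 * e2)%N.
  rewrite -(cards1 s) -(cards2 s) -card_exponents_split; apply: eq_card => m.
  by rewrite !inE /C /vanishes andbC andbACA.
have cardC : #|C| = (c1 * c2)%N.
  by rewrite -card1 -card2 -card_exponents_split.
have := @card_nonvanishing p q k C; rewrite !vanE cardC card_sig => cardB.
have {cardB} : (#|B| + e1 * e2 + e1 * e2 = c1 * c2)%N; last first.
  by move=> h; rewrite -!PoszM -h !PoszD addr0 opprD addrA !addrK.
apply: cardB => m /andP[/C1k k0 /C2l l0]; apply/negP => /andP[].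
move=> /andP[/forallP a0 /forallP b0] /andP[/forallP a1 /forallP b1].
move: kl; rewrite -k0 -l0 !big1 // => i _.
  by have := b0 i; have := b1 i; case: (m.2 i) => [[] []].
rewrite /pair_wt (eqP (a0 i : (m.1 i).1 == 0%N :> nat)).
by rewrite (eqP (a1 i : (m.1 i).2 == 0%N :> nat)).
Qed.

Lemma dim_multi_component (k : 'I_p -> nat) (l : 'I_q -> nat) :
  (1 < \sum_(i < p) k i + \sum_(j < q) l j)%N ->
  exists2 d : nat, has_dim (multi_component y z k l) d
    & d%:Z = \prod_(i < p) ((k i)%:Z + 1)
             * \prod_(j < q) ((l j == 2%N)%:Z + 2 * (l j == 1%N)%:Z
                              + (l j == 0%N)%:Z)
             - 2 * \prod_(j < q) ((l j == 1%N)%:Z + (l j == 0%N)%:Z).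
Proof.
move=> kl.
pose Q (w : word p q) := (forall i, word_deg w (inl i) = k i) /\
                         (forall j, word_deg w (inr j) = l j).
have ki i : (k i <= \sum_i k i)%N by rewrite (bigD1 i) //= leq_addr.
have [|w m em|f|g|||||d hd ed] := @has_dim_products Q (\sum_i k i) (\sum_j l j)
  [pred f : {ffun 'I_p -> _} | [forall i, pair_wt (f i) == k i]]
  [pred g : {ffun 'I_q -> _} | [forall j, bool_wt (g j) == l j]]
  (\prod_i (k i).+1) (\prod_j ((l j == 2) + 2 * (l j == 1) + (l j == 0)))
  1 (\prod_j ((l j == 1) + (l j == 0))) kl.
- by move=> w [wk wl]; split; apply: eq_bigr => i _.
- have [e1 e2] := word_deg_exponents em.
  split=> [[h1 h2]|/andP[/forallP h1 /forallP h2]].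
    by apply/andP; split; apply/forallP => i; apply/eqP; rewrite -?e1 -?e2.
  by split=> i; rewrite ?e1 ?e2; apply/eqP.
- by move=> /forallP h; apply: eq_bigr => i _; apply/eqP/h.
- by move=> /forallP h; apply: eq_bigr => i _; apply/eqP/h.
- apply: etrans (card_ffun_forall (fun i ab => pair_wt ab == k i)) _.
  by apply: eq_bigr => i _; apply: card_pair_wt.
- apply: etrans (card_ffun_forall (fun j ab => bool_wt ab == l j)) _.
  by apply: eq_bigr => j _; apply: card_bool_wt.
- move=> s; rewrite [RHS](_ : _ = \prod_(i < p) 1)%N; last by rewrite big1.
  refine (etrans (etrans _ (card_ffun_forall
    (fun i (ab : 'I_(\sum_i k i).+1 * 'I_(\sum_i k i).+1) =>
      (side s ab == 0%N :> nat) && (pair_wt ab == k i)))) _).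
    by apply: eq_card => f; rewrite !inE forallb_andb.
  by apply: eq_bigr => i _; apply: card_pair_wt_side.
- move=> s; refine (etrans (etrans _ (card_ffun_forall
    (fun j ab => ~~ side s ab && (bool_wt ab == l j)))) _).
    by apply: eq_card => g; rewrite !inE forallb_andb.
  by apply: eq_bigr => j _; apply: card_bool_wt_side.
exists d.
  by apply: has_dim_ext hd => v; split=> [[w [h1 h2]]|[w [h1 h2]]]; exists w.
rewrite ed mul1r !(big_morph Posz PoszM (erefl _)).
by congr (_ * _ - _); apply: eq_bigr => i _; rewrite -addn1.
Qed.

(** A multidegree of total 1 is that of one generator [x0], which is the only
    word of this multidegree. *)
Lemma dim_multi_component1 (k : 'I_p -> nat) (l : 'I_q -> nat) :
  (\sum_(i < p) k i + \sum_(j < q) l j)%N = 1%N ->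
  has_dim (multi_component y z k l) 1.
Proof.
move=> kl.
pose deg (x : 'I_p + 'I_q) := match x with inl i => k i | inr j => l j end.
have tot : (\sum_x deg x)%N = 1%N by rewrite big_sumType.
have [x0 hx0] : exists x0, forall x, deg x = (x0 == x).
  have [x0 nx0] : exists x0, deg x0 != 0%N.
    apply/existsP; apply: contraPT tot => /existsPn h.
    by rewrite big1 // => x _; apply/eqP; have := h x; rewrite negbK.
  move: tot; rewrite (bigD1 x0) //= => tot; exists x0 => x.
  case: eqP => [<-|/eqP nx]; first by lia.
  by move: tot; rewrite (bigD1 x) 1?eq_sym //=; lia.
pose Q (w : word p q) := forall x, word_deg w x = deg x.
apply: (has_dim_ext (P := fun v : F => exists2 w, Q w & v = word_eval y z w)).
  move=> v; split=> [[w h e]|[w [h1 h2 e]]]; exists w => //.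
  by case=> i; [apply: h1 | apply: h2].
have <- : #|'I_1| = 1%N by rewrite card_ord.
apply: (has_dim_words charK freeF (w_ := fun=> Gen x0)) => //.
- by move=> _ x; rewrite hx0.
- by move=> _ v _; apply: leq_b1.
- by move=> i j _; rewrite !ord1.
move=> w Qw _; exists ord0.
have : ~~ is_mul w.
  rewrite is_mul_word_total /word_total; under eq_bigr => i _ do rewrite Qw.
  by under [X in (_ + X)%N]eq_bigr => i _ do rewrite Qw; rewrite kl.
case: w Qw => // x /(_ x) /=; rewrite eqxx hx0; case: eqP => // ->.
by [].
Qed.

(** The even part has generating function [(1 + X + ... + X^k) ^ (2 p)], and the
    odd part [(1 + X) ^ (2 q)]; one side alone halves the exponents. *)
Lemma dim_bi_component (k l : nat) : (1 < k + l)%N ->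
  exists2 d : nat, has_dim (bi_component y z k l) d
    & d%:Z = (multichoose (2 * p) k)%:Z * ('C(2 * q, l))%:Z
             - 2 * ((multichoose p k)%:Z * ('C(q, l))%:Z).
Proof.
move=> kl.
pose Q (w : word p q) := (\sum_(i < p) word_deg w (inl i))%N = k /\
                         (\sum_(j < q) word_deg w (inr j))%N = l.
have [|w m em|f|g|||||d hd ed] := @has_dim_products Q k l
  [pred f : {ffun 'I_p -> _} | \sum_i pair_wt (f i) == k]%N
  [pred g : {ffun 'I_q -> _} | \sum_j bool_wt (g j) == l]%N
  (multichoose (2 * p) k) 'C(2 * q, l) (multichoose p k) 'C(q, l) kl.
- by [].
- have [e1 e2] := word_deg_exponents em; rewrite /Q /=.
  under eq_bigr => i _ do rewrite e1.
  under [X in _ /\ X = _]eq_bigr => i _ do rewrite e2.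
  by split=> [[-> ->]|/andP[/eqP -> /eqP ->]]; rewrite ?eqxx.
- by move=> /eqP.
- by move=> /eqP.
- have := coef_gf_expT 'I_p (@pair_wt k) k.
  by rewrite card_ord gf_pair_wt -exprM coef_geometric_exp // => -[].
- have := coef_gf_expT 'I_q bool_wt l.
  by rewrite card_ord gf_bool_wt -exprM coef_1X_exp => -[].
- move=> s; have := coef_gf_exp 'I_p
    (fun ab : 'I_k.+1 * 'I_k.+1 => side s ab == 0%N :> nat) (@pair_wt k) k.
  by rewrite card_ord gf_pair_wt_side coef_geometric_exp // => -[].
- move=> s; have := coef_gf_exp 'I_q (fun ab => ~~ side s ab) bool_wt l.
  by rewrite card_ord gf_bool_wt_side coef_1X_exp => -[].
exists d => //; apply: has_dim_ext hd => v.
by split=> [[w [h1 h2]]|[w [h1 h2]]]; exists w.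
Qed.

Lemma dim_bi_component1 (a b n : nat) (x_ : 'I_n -> 'I_p + 'I_q) :
  injective x_ -> (a + b = 1)%N ->
  (forall x, (\sum_(i < p) word_deg (Gen x) (inl i))%N = a /\
     (\sum_(j < q) word_deg (Gen x) (inr j))%N = b <-> exists i, x = x_ i) ->
  has_dim (bi_component y z a b) n.
Proof.
move=> inj ab H.
pose Q (w : word p q) := (\sum_(i < p) word_deg w (inl i))%N = a /\
                         (\sum_(j < q) word_deg w (inr j))%N = b.
apply: (has_dim_ext (P := fun v : F => exists2 w, Q w & v = word_eval y z w)).
  by move=> v; split=> [[w [h1 h2]]|[w [h1 h2]]]; exists w.
rewrite -[n in has_dim _ n]card_ord.
apply: (has_dim_words charK freeF (w_ := fun i => Gen (x_ i))).
- by move=> i; apply/H; exists i.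
- by move=> i v _; apply: leq_b1.
- by move=> i j /(_ (x_ i, false)) /=; rewrite eqxx; case: eqP => // -[/inj].
move=> [x|w w'] Qw _; first by have [i ->] := (H x).1 Qw; exists i.
by have := is_mul_word_total (Mul w w'); rewrite /word_total Qw.1 Qw.2 ab.
Qed.
End Dim.

Lemma sum_word_deg_Gen p q (x : 'I_p + 'I_q) :
  (\sum_(i < p) word_deg (Gen x) (inl i))%N = ~~ gen_par x /\
  (\sum_(j < q) word_deg (Gen x) (inr j))%N = gen_par x.
Proof.
have delta n (i : 'I_n) : (\sum_(j < n) (i == j))%N = 1%N.
  by rewrite (bigD1 i) //= eqxx big1 // => j /negbTE; rewrite eq_sym => ->.
case: x => i; split; first exact: delta.
- exact: big1.
- exact: big1.
exact: delta.
Qed.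

Theorem corollary3p3 (K : fieldType) (charK : 2%N \notin [pchar K])
    (p q : nat) (F : superalgebra K) (y : 'I_p -> F) (z : 'I_q -> F)
    (freeF : free_bicommutative y z) :
  (forall (k : 'I_p -> nat) (l : 'I_q -> nat),
     ((1 < \sum_(i < p) k i + \sum_(j < q) l j)%N ->
        exists2 d : nat, has_dim (multi_component y z k l) d
          & d%:Z = \prod_(i < p) ((k i)%:Z + 1)
                   * \prod_(j < q) ((l j == 2%N)%:Z + 2 * (l j == 1%N)%:Z
                                    + (l j == 0%N)%:Z)
                   - 2 * \prod_(j < q) ((l j == 1%N)%:Z + (l j == 0%N)%:Z))
     /\ ((\sum_(i < p) k i + \sum_(j < q) l j)%N = 1%N ->
           has_dim (multi_component y z k l) 1))
  /\ (forall k l : nat,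
        (1 < k + l)%N ->
        exists2 d : nat, has_dim (bi_component y z k l) d
          & d%:Z = (multichoose (2 * p) k)%:Z * ('C(2 * q, l))%:Z
                   - 2 * ((multichoose p k)%:Z * ('C(q, l))%:Z))
  /\ has_dim (bi_component y z 1 0) p
  /\ has_dim (bi_component y z 0 1) q.
Proof.
split=> [k l|].
  split; first exact: dim_multi_component.
  exact: dim_multi_component1.
split; first exact: dim_bi_component.
split.
  apply: (dim_bi_component1 charK freeF (x_ := inl)) => [i j [->]||x] //.
  have [-> ->] := sum_word_deg_Gen x.
  by case: x => i; split=> [[]|[]] //=; exists i.
apply: (dim_bi_component1 charK freeF (x_ := inr)) => [i j [->]||x] //.
have [-> ->] := sum_word_deg_Gen x.
by case: x => i; split=> [[]|[]] //=; exists i.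
Qed.
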